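(* Let $\mathcal{G}=(\mathcal{V},\mathcal{E})$ be a $(d,m)$-graph with bipartition $\mathcal{V}=\mathcal{V}_1\,\dot\cup\,\mathcal{V}_2$, $\mathcal{V}=\{1,\dots,2m\}$, and let $$f(x)=\sum_{e\in\mathcal{E}}\phi(x_{\rho(e)},x_{\tau(e)}),\qquad x\in\mathbb{R}^{2m},$$ with $\phi:\mathbb{R}^2\to\mathbb{R}$ smooth and $\mathbf{Z}_2$-invariant. Let $x_0\neq y_0$ be real numbers and let $\bar x=(x_1,\dots,x_{2m})$ be the 2-colour pattern given by $x_i=x_0$ for $i\in\mathcal{V}_1$ and $x_i=y_0$ for $i\in\mathcal{V}_2$. Then $\bar x$ is a minimum of $f$ if and only if $(x_0,y_0)$ is a minimum of the coupling function $\phi$.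
   Context: A $(d,m)$-graph is a finite connected undirected simple graph that is $d$-regular ($d\ge 1$) and bipartite with parts satisfying $|\mathcal{V}_1|=|\mathcal{V}_2|=m$. Each vertex carries a one-dimensional variable $x_i\in\mathbb{R}$. For an edge $e$, $\rho(e),\tau(e)$ are its two endpoints (order irrelevant since $\phi$ is symmetric). $\mathbf{Z}_2$-invariant means $\phi(x,y)=\phi(y,x)$. ''Minimum'' means local minimum. *)

(* Defs.v *)
From HB Require Import structures.
From mathcomp Require Import all_boot all_order all_algebra.
Set Implicit Arguments.
Unset Strict Implicit.
Unset Printing Implicit Defensive.

(** A simple graph on a finite vertex type [T] is given by its set of edges,
    each edge being the unordered pair of its two distinct endpoints. *)

Definition simple_graph (T : finType) (E : {set {set T}}) : Prop :=
  forall e, e \in E -> #|e| = 2%N.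

Definition adjacent (T : finType) (E : {set {set T}}) : rel T :=
  fun u v => [set u; v] \in E.

(** The graph without vertices does not count as connected. *)
Definition graph_connected (T : finType) (E : {set {set T}}) : Prop :=
  (0 < #|T|)%N /\ forall u v : T, connect (adjacent E) u v.

Definition regular (T : finType) (E : {set {set T}}) (d : nat) : Prop :=
  forall v : T, #|[set e in E | v \in e]| = d.

Definition bipartition (T : finType) (E : {set {set T}}) (V1 V2 : {set T}) : Prop :=
  [/\ V1 :|: V2 = [set: T], [disjoint V1 & V2]
    & forall u v, adjacent E u v ->
        (u \in V1) && (v \in V2) || (u \in V2) && (v \in V1)].

Record dm_graph (d m : nat) (E : {set {set 'I_(2 * m)}})
    (V1 V2 : {set 'I_(2 * m)}) : Prop := DmGraph {
  dm_degree_pos : (1 <= d)%N;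
  dm_simple : simple_graph E;
  dm_connected : graph_connected E;
  dm_regular : regular E d;
  dm_bipartition : bipartition E V1 V2;
  dm_card1 : #|V1| = m;
  dm_card2 : #|V2| = m }.

(** [rho] and [tau] pick the two endpoints of each edge, in some order. *)
Definition endpoints (T : finType) (E : {set {set T}}) (rho tau : {set T} -> T) : Prop :=
  forall e, e \in E -> e = [set rho e; tau e].

(* Loaded only here, because classical_sets redefines the notations of finset. *)
From mathcomp Require Import boolp classical_sets reals topology normedtype derive.
Import Order.TTheory GRing.Theory Num.Theory.
Import numFieldNormedType.Exports.

Local Open Scope classical_set_scope.
Local Open Scope ring_scope.

Definition network_fun (R : realType) (n : nat) (E : {set {set 'I_n}})
    (rho tau : {set 'I_n} -> 'I_n) (phi : R * R -> R) (x : 'rV[R]_n) : R :=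
  \sum_(e in E) phi (x ord0 (rho e), x ord0 (tau e)).

(** All partial derivatives of order at most [k] exist everywhere, and those of
    order exactly [k] are continuous (hence so are the lower-order ones). *)
Fixpoint class_C (R : realType) (k : nat) (phi : R * R -> R) : Prop :=
  if k is k'.+1 then
    [/\ forall p, derivable phi p (1, 0), forall p, derivable phi p (0, 1),
        class_C k' ('D_(1, 0) phi) & class_C k' ('D_(0, 1) phi)]
  else continuous phi.

Definition smooth (R : realType) (phi : R * R -> R) : Prop :=
  forall k, class_C k phi.

Definition Z2_invariant (R : realType) (phi : R * R -> R) : Prop :=
  forall x y, phi (x, y) = phi (y, x).

Definition local_min (R : realType) (X : topologicalType) (f : X -> R) (a : X) : Prop :=
  \forall x \near a, f a <= f x.

(* Main.v *)
Require Import Defs.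
From mathcomp Require Import all_boot all_order all_algebra.
From mathcomp Require Import reals topology normedtype.
Import Order.TTheory GRing.Theory Num.Theory.
Import numFieldNormedType.Exports.

Local Open Scope ring_scope.

(** Every edge joins a vertex coloured [x0] to a vertex coloured [y0], so, [phi]
    being symmetric, each summand of [f] at the 2-colour pattern of [(a, b)]
    equals [phi (a, b)].  Hence [f] restricted to the plane of 2-colour patterns
    is [#|E|] times [phi]; as there is at least one edge, a minimum of [f] at
    the pattern is a minimum of [phi].  Conversely, if [phi] is minimal at
    [(x0, y0)], then at any configuration near the pattern, 2-coloured or not,
    each summand of [f] is at least its value at the pattern; so the same holds
    of their sum.  Neither direction changes the radius of the neighbourhood:
    balls of row vectors and of pairs are those of the sup norm, so the colours
    of a pattern move by exactly as much as the pattern itself. *)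

Set Implicit Arguments.
Unset Strict Implicit.

Lemma regular_edges_gt0 (T : finType) (E : {set {set T}}) (d : nat) :
  (0 < #|T|)%N -> (0 < d)%N -> regular E d -> (0 < #|E|)%N.
Proof.
move=> /card_gt0P [v _] d0 /(_ v) deg_v.
apply: (@leq_trans #|[set e in E | v \in e]|); first by rewrite deg_v.
by apply: subset_leq_card; apply/subsetP=> e; rewrite inE => /andP [].
Qed.

Lemma endpoints_bipartition (T : finType) (E : {set {set T}}) (V1 V2 : {set T})
    (rho tau : {set T} -> T) (e : {set T}) :
  bipartition E V1 V2 -> endpoints E rho tau -> e \in E ->
  (rho e \in V1) && (tau e \in V2) || (rho e \in V2) && (tau e \in V1).
Proof.
by move=> [_ _ V12] ends eE; apply: V12; rewrite /adjacent -ends.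
Qed.

Section TwoColourPattern.

Variables (R : realType) (n : nat) (E : {set {set 'I_n}}) (V1 V2 : {set 'I_n}).
Variables (rho tau : {set 'I_n} -> 'I_n).
Hypotheses (bip : bipartition E V1 V2) (ends : endpoints E rho tau).

Definition two_colour (a b : R) : 'rV[R]_n :=
  \row_i (if i \in V1 then a else b).

Lemma two_colour_l (a b : R) (i : 'I_n) :
  i \in V1 -> two_colour a b ord0 i = a.
Proof. by move=> iV1; rewrite mxE iV1. Qed.

Lemma two_colour_r (a b : R) (i : 'I_n) :
  i \in V2 -> two_colour a b ord0 i = b.
Proof.
by have [_ dis _] := bip; move=> iV2; rewrite mxE (disjointFl dis iV2).
Qed.

Lemma two_colour_unique (a b : R) (x : 'rV[R]_n) :
  (forall i, i \in V1 -> x ord0 i = a) ->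
  (forall i, i \in V2 -> x ord0 i = b) -> x = two_colour a b.
Proof.
have [cover _ _] := bip; move=> xV1 xV2; apply/rowP=> i.
have := in_setT i; rewrite -cover inE => /orP [iV1|iV2].
  by rewrite two_colour_l ?xV1.
by rewrite two_colour_r ?xV2.
Qed.

Variables (phi : R * R -> R) (phi_sym : Z2_invariant phi).

(** [rho] and [tau] may list the endpoints of [e] in either order; the symmetry
    of [phi] allows the endpoint in [V1] to be put first. *)
Lemma oriented_edge (e : {set 'I_n}) : e \in E ->
  exists u v, [/\ u \in V1, v \in V2 &
    forall x : 'rV[R]_n,
      phi (x ord0 (rho e), x ord0 (tau e)) = phi (x ord0 u, x ord0 v)].
Proof.
move=> /(endpoints_bipartition bip ends) /orP [] /andP [rhoV tauV].
  by exists (rho e), (tau e).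
by exists (tau e), (rho e); split=> // x; exact: phi_sym.
Qed.

Lemma network_fun_two_colour (a b : R) :
  network_fun E rho tau phi (two_colour a b) = phi (a, b) *+ #|E|.
Proof.
rewrite /network_fun -sumr_const; apply: eq_bigr => e /oriented_edge.
by move=> [u [v [uV1 vV2 ->]]]; rewrite two_colour_l ?two_colour_r.
Qed.

Lemma ball_two_colour (a b a' b' eps : R) :
  0 < eps -> ball (a, b) eps (a', b') ->
  ball (two_colour a b) eps (two_colour a' b').
Proof.
by move=> eps0 [aa' bb']; split=> // i j; rewrite !mxE; case: ifP.
Qed.

(** [p |-> two_colour p.1 p.2] maps balls into balls of the same
    radius, and [f] composed with it is a positive multiple of [phi]. *)
Lemma local_min_coupling (a b : R) : (0 < #|E|)%N ->
  local_min (network_fun E rho tau phi) (two_colour a b) ->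
  local_min phi (a, b).
Proof.
move=> E0 /nbhs_ballP [eps /= eps0 minf].
apply/nbhs_ballP; exists eps => // -[a' b'] /(ball_two_colour eps0).
by move=> /minf /=; rewrite !network_fun_two_colour lerMn2r eqn0Ngt E0.
Qed.

(** Each summand of [f] is separately minimal at the pattern, since it only
    depends on two coordinates, which stay within the radius chosen for [phi]. *)
Lemma local_min_network (a b : R) :
  local_min phi (a, b) ->
  local_min (network_fun E rho tau phi) (two_colour a b).
Proof.
move=> /nbhs_ballP [eps /= eps0 minphi].
apply/nbhs_ballP; exists eps => // x [_ near_x] /=.
apply: ler_sum => e /oriented_edge [u [v [uV1 vV2 eqphi]]].
rewrite !eqphi two_colour_l // two_colour_r //.
apply: (minphi (_, _)); split => /=.
  by have := near_x ord0 u; rewrite two_colour_l.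
by have := near_x ord0 v; rewrite two_colour_r.
Qed.

End TwoColourPattern.

Unset Implicit Arguments.
Set Strict Implicit.

Theorem proposition3p8 (R : realType) (d m : nat)
    (E : {set {set 'I_(2 * m)}}) (V1 V2 : {set 'I_(2 * m)})
    (hG : dm_graph d E V1 V2)
    (rho tau : {set 'I_(2 * m)} -> 'I_(2 * m)) (hends : endpoints E rho tau)
    (phi : R * R -> R) (phi_smooth : smooth phi) (phi_sym : Z2_invariant phi)
    (x0 y0 : R) (hxy : x0 <> y0)
    (xbar : 'rV[R]_(2 * m))
    (hV1 : forall i, i \in V1 -> xbar ord0 i = x0)
    (hV2 : forall i, i \in V2 -> xbar ord0 i = y0) :
  local_min (network_fun E rho tau phi) xbar <-> local_min phi (x0, y0).
Proof.
have [d0 _ [T0 _] reg bip _ _] := hG.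
rewrite (two_colour_unique bip hV1 hV2); split.
  have E0 := regular_edges_gt0 T0 d0 reg.
  exact (local_min_coupling bip hends phi_sym E0).
by move=> minphi; exact (local_min_network bip hends phi_sym minphi).
Qed.
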